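(* Let $L \in \mathbb{R}^{n\times n}$ be the combinatorial directed Laplacian of a directed weighted graph on $n$ vertices, and assume $L$ is diagonalizable, $L = V\Lambda V^{-1}$ with $V\in\mathbb{C}^{n\times n}$ invertible and $\Lambda$ diagonal. Let $\sigma_{\min}(V)$ and $\sigma_{\max}(V)$ denote the smallest and largest singular values of $V$. Then for every $x\in\mathbb{C}^n$, with BGFT coefficients $\hat{x}:=V^{-1}x$, $$\sigma_{\min}^2(V)\,\|\hat{x}\|_2^2 \;\le\; \|x\|_2^2 \;\le\; \sigma_{\max}^2(V)\,\|\hat{x}\|_2^2.$$
   Context: Directed Laplacian: for a directed weighted graph on vertex set $\{1,\dots,n\}$ with real edge weights $w(i,j)$, the adjacency matrix $A\in\mathbb{R}^{n\times n}$ has $A_{ij}=w(i,j)$ if $(i,j)$ is an edge (oriented $i\to j$) and $A_{ij}=0$ otherwise; the out-degrees are $d_i^{\mathrm{out}}=\sum_{j=1}^n A_{ij}$, $D_{\mathrm{out}}=\operatorname{diag}(d_1^{\mathrm{out}},\dots,d_n^{\mathrm{out}})$, and $L := D_{\mathrm{out}}-A$. Eigendecomposition: $L$ is diagonalizable over $\mathbb{C}$: $L=V\Lambda V^{-1}$ with $V=[v_1,\dots,v_n]$ an invertible matrix of right eigenvectors, $Lv_k=\lambda_k v_k$, and $\Lambda=\operatorname{diag}(\lambda_1,\dots,\lambda_n)$. The eigenvectors need not be orthogonal or normalized. BGFT (Biorthogonal Graph Fourier Transform): the coefficient vector of $x\in\mathbb{C}^n$ is $\hat{x}=V^{-1}x$,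 so $x=V\hat{x}$. $\|\cdot\|_2$ is the Euclidean norm. *)

(* Defs.v *)
From mathcomp Require Import all_boot all_order all_algebra.
From mathcomp Require Import spectral sesquilinear.
From mathcomp Require Import complex.
From mathcomp Require Import reals.

Set Implicit Arguments.
Unset Strict Implicit.
Unset Printing Implicit Defensive.

Import Order.TTheory GRing.Theory Num.Theory.
Local Open Scope ring_scope.
Local Open Scope complex_scope.
Local Open Scope sesquilinear_scope.

(* Self-loops are allowed; weight i j is only meaningful when edge i j holds. *)
Record wdigraph (R : Type) (n : nat) := WDigraph {
  edge : rel 'I_n;
  weight : 'I_n -> 'I_n -> R }.

Definition adjacency (R : realType) n (G : wdigraph R n) : 'M[R]_n :=
  \matrix_(i, j) (if edge G i j then weight G i j else 0).

Definition outdegree (R : realType) n (G : wdigraph R n) : 'rV[R]_n :=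
  \row_i \sum_(j < n) adjacency G i j.

Definition laplacian (R : realType) n (G : wdigraph R n) : 'M[R]_n :=
  diag_mx (outdegree G) - adjacency G.

Definition bgft (R : realType) n (V : 'M[R[i]]_n) (x : 'cV[R[i]]_n) :
    'cV[R[i]]_n :=
  invmx V *m x.

(* The library's norm on matrices is the sup norm, hence this definition. *)
Definition norm2 (R : realType) n (x : 'cV[R[i]]_n) : R :=
  Num.sqrt (\sum_(k < n) ComplexField.Normc.normc (x k 0) ^+ 2).

(* Square roots of the eigenvalues of V^* V, listed with multiplicity; that
   matrix is positive semidefinite, so its eigenvalues are real and nonnegative
   and taking Re loses nothing (see singular_valuesP). *)
Definition singular_values (R : realType) n (V : 'M[R[i]]_n) : seq R :=
  [seq Num.sqrt (complex.Re (spectral_diag (V^t* *m V) 0 k)) | k <- enum 'I_n].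

(* Both are 0 in the degenerate case n = 0, where there is no singular value. *)
Definition sigma_min (R : realType) n (V : 'M[R[i]]_n) : R :=
  let s := singular_values V in \big[Num.min/head 0 s]_(t <- s) t.

Definition sigma_max (R : realType) n (V : 'M[R[i]]_n) : R :=
  let s := singular_values V in \big[Num.max/head 0 s]_(t <- s) t.

Lemma eigenvalue_spectral_diag (C : numClosedFieldType) n (A : 'M[C]_n) a :
  A \is normalmx ->
  reflect (exists k, spectral_diag A 0 k = a) (eigenvalue A a).
Proof.
move=> /orthomx_spectralP A_eq.
have Pu : spectralmx A \in unitmx by apply: spectral_unit.
set P := spectralmx A in A_eq Pu; set d := spectral_diag A in A_eq *.
have PA : P *m A = diag_mx d *m P by rewrite A_eq !mulmxA mulmxV ?mul1mx.
have rowP' k : row k (diag_mx d *m P) = d 0 k *: row k P.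
  by apply/rowP => j; rewrite mul_diag_mx !mxE.
apply: (iffP eigenvalueP) => [[v vA v0]|[k <-]].
  pose w := v *m invmx P.
  have w0 : w != 0.
    apply: contraNneq v0 => w0.
    by rewrite -[v]mulmx1 -(mulVmx Pu) mulmxA -/w w0 mul0mx.
  have wd : w *m diag_mx d = a *: w.
    by rewrite /w scalemxAl -vA [in RHS]A_eq !mulmxA mulmxK.
  clearbody w; have [k wk] : exists k, w 0 k != 0.
    apply/existsP; apply: contraNT w0; rewrite negb_exists => /forallP w0.
    by apply/eqP/rowP => k; rewrite [RHS]mxE; apply/eqP; have := w0 k; rewrite negbK.
  exists k; move/rowP: wd => /(_ k); rewrite mul_mx_diag !mxE mulrC.
  by move/(mulIf wk).
exists (row k P).
  by rewrite -row_mul PA rowP'.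
apply: contraTneq Pu => rk0.
apply/negP => Pu.
have: row k (P *m invmx P) = 0 by rewrite row_mul rk0 mul0mx.
rewrite mulmxV // => /rowP /(_ k); rewrite !mxE eqxx => /eqP.
by rewrite oner_eq0.
Qed.

Lemma gram_normalmx (C : numClosedFieldType) n (V : 'M[C]_n) :
  V^t* *m V \is normalmx.
Proof.
apply/normalmxP.
by rewrite trmx_mul map_mxM trmxCK.
Qed.

Lemma gram_eigenvalue_ge0 (C : numClosedFieldType) n (V : 'M[C]_n) a :
  eigenvalue (V^t* *m V) a -> 0 <= a.
Proof.
move=> /eigenvalueP[v vA v0].
have nz m (u : 'rV[C]_m) : (u *m u^t*) 0 0 = \sum_k `|u 0 k| ^+ 2.
  by rewrite mxE; apply: eq_bigr => k _; rewrite !mxE normCK.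
pose w := v *m V^t*.
have E : (w *m w^t*) 0 0 = a * (v *m v^t*) 0 0.
  have -> : w^t* = V *m v^t*.
    by rewrite /w trmx_mul map_mxM trmxCK.
  by rewrite /w mulmxA -[_ *m V]mulmxA vA -scalemxAl mxE.
have v_gt0 : 0 < (v *m v^t*) 0 0.
  rewrite nz lt_def sumr_ge0 ?andbT => [|k _]; last exact: exprn_ge0.
  apply: contraNneq v0 => /eqP; rewrite psumr_eq0 => [/allP v0|k _]; last exact: exprn_ge0.
  apply/eqP/rowP => k; rewrite mxE; apply/eqP.
  by have := v0 k (mem_index_enum k); rewrite /= sqrf_eq0 normr_eq0.
rewrite -(pmulr_lge0 a v_gt0) -E nz.
by apply: sumr_ge0 => k _; apply: exprn_ge0.
Qed.

Lemma singular_valuesP (R : realType) n (V : 'M[R[i]]_n) (s : R) :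
  s \in singular_values V =
  (0 <= s) && eigenvalue (V^t* *m V) ((s ^+ 2)%:C).
Proof.
have ge0 k : 0 <= spectral_diag (V^t* *m V) 0 k.
  apply: (@gram_eigenvalue_ge0 _ _ V).
  by apply/(eigenvalue_spectral_diag _ (gram_normalmx V)); exists k.
have ReE k : (complex.Re (spectral_diag (V^t* *m V) 0 k))%:C =
    spectral_diag (V^t* *m V) 0 k /\ 0 <= complex.Re (spectral_diag (V^t* *m V) 0 k).
  have := ge0 k; case: (spectral_diag _ 0 k) => a b.
  by rewrite lecE /= => /andP[/eqP -> ->].
apply/mapP/andP => [[k _ ->]|[s0]].
  split; first exact: sqrtr_ge0.
  apply/(eigenvalue_spectral_diag _ (gram_normalmx V)); exists k.
  by have [E ge] := ReE k; rewrite sqr_sqrtr.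
move=> /(eigenvalue_spectral_diag _ (gram_normalmx V))[k E].
by exists k; rewrite ?mem_enum // E /= sqrtr_sqr ger0_norm.
Qed.

(* Main.v *)
(* With V^* V = P^* diag(d) P for a unitary P, the squared norm of V y is the
   sum of d_k |(P y)_k|^2.  Each d_k is the square of a singular value of V and
   P y has the norm of y, so this sum lies between the two extreme squared
   singular values times the squared norm of y.  Take y = V^-1 x. *)
Require Import Defs.
From mathcomp Require Import all_boot all_order all_algebra.
From mathcomp Require Import complex reals.
From mathcomp Require Import spectral sesquilinear.

Set Implicit Arguments.
Unset Strict Implicit.
Unset Printing Implicit Defensive.

Import Order.TTheory GRing.Theory Num.Theory.
Local Open Scope ring_scope.
Local Open Scope complex_scope.

Lemma normc_sqr (R : realType) (z : R[i]) :
  (ComplexField.Normc.normc z ^+ 2)%:C = z * Num.conj z.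
Proof. by rewrite -normCK normc_def rmorphXn; case: z. Qed.

Lemma norm2_sqr (R : realType) n (u : 'cV[R[i]]_n) :
  norm2 u ^+ 2 = \sum_k ComplexField.Normc.normc (u k 0) ^+ 2.
Proof. by rewrite sqr_sqrtr // sumr_ge0 // => k _; apply: sqr_ge0. Qed.

(** In the form [u^* u] the squared norm of a product expands by adjoints, so norm identities become
    matrix algebra over [R[i]]. *)
Lemma norm2_sqr_form (R : realType) n (u : 'cV[R[i]]_n) :
  (norm2 u ^+ 2)%:C = ((u^t*)%sesqui *m u) 0 0.
Proof.
rewrite norm2_sqr rmorph_sum mxE; apply: eq_bigr => k _.
by rewrite /= normc_sqr !mxE mulrC.
Qed.

Lemma norm2_unitary (R : realType) n (P : 'M[R[i]]_n) (u : 'cV[R[i]]_n) :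
  P \is unitarymx -> norm2 (P *m u) ^+ 2 = norm2 u ^+ 2.
Proof.
move=> Pu; apply: (@complexI R); rewrite !norm2_sqr_form trmx_mul map_mxM.
by rewrite -invmx_unitary // mulmxA mulmxKV // unitarymx_unit.
Qed.

(** The Gram matrix is positive semidefinite, so its eigenvalues are real and the real square root
    loses nothing. This ties singular values to spectral indices. *)
Lemma gram_spectral_diag (R : realType) n (V : 'M[R[i]]_n) k :
  exists2 s, s \in singular_values V &
    spectral_diag ((V^t*)%sesqui *m V) 0 k = (s ^+ 2)%:C.
Proof.
set d := spectral_diag _ 0 k.
have d0 : 0 <= d.
  apply: (@gram_eigenvalue_ge0 _ _ V).
  by apply/(eigenvalue_spectral_diag _ (gram_normalmx V)); exists k.
exists (Num.sqrt (complex.Re d)); first by apply/map_f; rewrite mem_enum.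
by case: d d0 => a b; rewrite lecE /= => /andP[/eqP -> a0]; rewrite sqr_sqrtr.
Qed.

Lemma norm2_mulmx (R : realType) n (V : 'M[R[i]]_n) (y : 'cV[R[i]]_n)
    (z := spectralmx ((V^t*)%sesqui *m V) *m y) (s : 'I_n -> R) :
    (forall k, spectral_diag ((V^t*)%sesqui *m V) 0 k = (s k ^+ 2)%:C) ->
  norm2 (V *m y) ^+ 2 =
  \sum_k s k ^+ 2 * ComplexField.Normc.normc (z k 0) ^+ 2.
Proof.
move=> ds; apply: (@complexI R); rewrite norm2_sqr_form trmx_mul map_mxM.
rewrite mulmxA -[_ *m _ *m V]mulmxA.
(* The spectral theorem splits [V^* V] as [P^-1 diag(d) P]; since [P^-1 = P^*], the left factor
   [y^* P^*] becomes [z^*]. *)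
rewrite [in LHS](orthomx_spectralP (gram_normalmx V)).
rewrite invmx_unitary ?spectral_unitarymx // !mulmxA -map_mxM -trmx_mul.
rewrite -(mulmxA _ _ y) -/z mul_mx_diag rmorph_sum mxE; apply: eq_bigr => k _.
rewrite [RHS](rmorphM (real_complex R)) /= normc_sqr -ds !mxE.
by rewrite mulrAC mulrC; congr (_ * _); apply: mulrC.
Qed.

Lemma sigma_min_ge0 (R : realType) n (V : 'M[R[i]]_n) : 0 <= sigma_min V.
Proof.
have s0 : all (>= 0) (singular_values V).
  by apply/allP => t; rewrite singular_valuesP => /andP[].
rewrite /sigma_min big_seq; apply: le_bigmin => [|t /(allP s0)//].
(* The default of the minimum is [0] on an empty list and otherwise the first singular value. *)
by case: (singular_values V) s0 => //= a s /andP[].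
Qed.

(** Squaring preserves these inequalities because all three numbers are nonnegative. *)
Lemma sigma_min_max (R : realType) n (V : 'M[R[i]]_n) s :
  s \in singular_values V ->
  sigma_min V ^+ 2 <= s ^+ 2 <= sigma_max V ^+ 2.
Proof.
move=> sV; have s0 : 0 <= s by move: sV; rewrite singular_valuesP => /andP[].
have sM : s <= sigma_max V by apply: le_bigmax_seq.
have ms : sigma_min V <= s by apply: ge_bigmin_seq.
by rewrite !lerXn2r ?nnegrE ?sigma_min_ge0 // (le_trans s0).
Qed.

Lemma norm2_mulmx_bounds (R : realType) n (V : 'M[R[i]]_n) (y : 'cV[R[i]]_n) :
  sigma_min V ^+ 2 * norm2 y ^+ 2 <= norm2 (V *m y) ^+ 2
    <= sigma_max V ^+ 2 * norm2 y ^+ 2.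
Proof.
have [s sV ds] := fin_all_exists2 (gram_spectral_diag V).
rewrite (norm2_mulmx y ds).
(* Replacing [y] by [P y] in the outer norms puts all sums in the same coordinates, so they compare
   term by term. *)
rewrite -(norm2_unitary y (spectral_unitarymx ((V^t*)%sesqui *m V))).
rewrite norm2_sqr !mulr_sumr; apply/andP.
by split; apply: ler_sum => k _; apply: ler_wpM2r; rewrite ?sqr_ge0 //;
  case/andP: (sigma_min_max (sV k)).
Qed.

Theorem corollary3p4 (R : realType) (n : nat) (G : wdigraph R n)
    (V : 'M[R[i]]_n) (lambda : 'rV[R[i]]_n)
    (V_unit : V \in unitmx)
    (L_diag : map_mx (real_complex R) (laplacian G)
              = V *m diag_mx lambda *m invmx V)
    (x : 'cV[R[i]]_n) :
  sigma_min V ^+ 2 * norm2 (bgft V x) ^+ 2 <= norm2 x ^+ 2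
    <= sigma_max V ^+ 2 * norm2 (bgft V x) ^+ 2.
Proof.
(* Occurrences 2 and 3 are the two copies of [norm2 x] in the chained inequality; the [x] inside
   [bgft] stays. *)
by rewrite -{2 3}(mulKVmx V_unit x); apply: norm2_mulmx_bounds.
Qed.
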